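(* Let $\mu$ and $\nu$ be finite Borel measures on $\mathbb{R}$ with $\operatorname{supp}\mu=[0,1]$ and $0,D\in\operatorname{supp}\nu\subset[0,D]$. Suppose $(b,c)\subset[0,D]$ is a gap in $\operatorname{supp}\nu$. If $c-b=1$, then $$\overline{\dim}_{loc}(\mu*\nu)(c)=\limsup_{r\to0}\frac{\log\big((\mu\times\nu)(B((0,c),r))+(\mu\times\nu)(B((1,b),r))\big)}{\log r}\le\min\{\overline{\dim}_{loc}(\mu\times\nu)(0,c),\ \overline{\dim}_{loc}(\mu\times\nu)(1,b)\}.$$
   Context: $\operatorname{supp}\mu$ is the support of $\mu$ and $B(x,r)$ is the ball of center $x$ and radius $r$. An interval $(b,c)$ contained in the convex hull of $\operatorname{supp}\nu$ is a gap in $\operatorname{supp}\nu$ if $b,c\in\operatorname{supp}\nu$ and $(b,c)\cap\operatorname{supp}\nu=\emptyset$. For a measure $\mu$ on a metric space and $x\in\operatorname{supp}\mu$, the upper local dimension is $\overline{\dim}_{loc}\mu(x)=\limsup_{r\to0}\frac{\log(\mu(B(x,r)))}{\log r}$. The convolution is $(\mu*\nu)(A)=\iint\chi_A(x+y)\,d\mu(x)\,d\nu(y)$. $\mu\times\nu$ is the product measure on $\mathbb{R}^2$, with the maximum metric, so that $B((x,y),r)=B(x,r)\times B(y,r)$. *)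

(* Defs.v *)
From HB Require Import structures.
From mathcomp Require Import all_boot all_order all_algebra.
From mathcomp Require Import all_classical all_reals all_analysis.
From mathcomp Require Import measurable_realfun.

Set Implicit Arguments.
Unset Strict Implicit.
Unset Printing Implicit Defensive.

Import Order.TTheory GRing.Theory Num.Theory.
Import numFieldNormedType.Exports.

Local Open Scope classical_set_scope.
Local Open Scope ring_scope.
Local Open Scope ereal_scope.

(* Measures enter the metric notions below only through their underlying set
   function: the library has no structure joining measurable and
   pseudometric types, and on R the measurable structure is carried by the
   alias measurableTypeR R (Borel sets) while the metric is carried by R. *)

Definition supp (R : realType) (T : pseudoMetricType R)
    (m : set T -> \bar R) : set T :=
  [set x | forall r : R, (0 < r)%R -> 0 < m (ball x r)].

(* lne and the quotient are extended-real valued, so that a null ball of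
   radius r < 1 contributes -oo / ln r = +oo. *)
Definition upper_local_dim (R : realType) (T : pseudoMetricType R)
    (m : set T -> \bar R) (x : T) : \bar R :=
  limf_esup (fun r : R => lne (m (ball x r)) / (ln r)%:E) 0^'+.

Definition is_gap (R : realType) (S : set R) (b c : R) : Prop :=
  [/\ (b < c)%R, `]b, c[ `<=` [set` Rhull S], S b, S c
    & `]b, c[ `&` S = set0].

Section convolution.
Context (R : realType).
Variables mu nu : {finite_measure set (measurableTypeR R) -> \bar R}.

Definition convolution (A : set (measurableTypeR R)) : \bar R :=
  \int[nu]_y \int[mu]_x (\1_A (x + y)%R)%:E.

Let add (p : measurableTypeR R * measurableTypeR R) : measurableTypeR R :=
  (p.1 + p.2)%R.

Let measurable_add : measurable_fun setT add.
Proof. exact: measurable_funD measurable_fst measurable_snd. Qed.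

Lemma convolutionE (A : set (measurableTypeR R)) : measurable A ->
  convolution A = pushforward (mu \x^ nu) add A.
Proof.
move=> mA; apply: eq_integral => y _ /=.
have mS : measurable (ysection (add @^-1` A) y).
  by apply: measurable_ysection; rewrite -[X in measurable X]setTI;
    exact: measurable_add.
transitivity (\int[mu]_x (\1_(ysection (add @^-1` A) y) x)%:E).
  by apply: eq_integral => x _; rewrite !indicE mem_ysection.
by rewrite integral_indic// setIT.
Qed.

Let convolution0 : convolution set0 = 0.
Proof. by rewrite convolutionE// measure0. Qed.

Let convolution_ge0 A : 0 <= convolution A.
Proof. by apply: integral_ge0 => y _; apply: integral_ge0 => x _; rewrite lee_fin. Qed.

Let convolution_semi_sigma_additive : semi_sigma_additive convolution.
Proof.
move=> F mF tF mUF; rewrite convolutionE//.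
rewrite (_ : (fun n => _) =
    fun n => \sum_(0 <= i < n) pushforward (mu \x^ nu) add (F i)); last first.
  by apply/funext => n; apply: eq_bigr => i _; rewrite convolutionE.
have mP A : measurable A -> measurable (add @^-1` A).
  by move=> mA; rewrite -[X in measurable X]setTI; exact: measurable_add.
rewrite /pushforward preimage_bigcup; apply: measure_semi_sigma_additive.
- by move=> n; exact: mP.
- apply/trivIsetP => /= i j _ _ ij; rewrite -preimage_setI.
  by move/trivIsetP : tF => /(_ _ _ _ _ ij) ->//; rewrite preimage_set0.
- by rewrite -preimage_bigcup; exact: mP.
Qed.

HB.instance Definition _ := isMeasure.Build _ _ _ convolution
  convolution0 convolution_ge0 convolution_semi_sigma_additive.

End convolution.

(* Main.v *)
Require Import Defs.
From HB Require Import structures.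
From mathcomp Require Import all_boot all_order all_algebra.
From mathcomp Require Import all_classical all_reals all_analysis.
From mathcomp Require Import measurable_realfun lra.

Import Order.TTheory GRing.Theory Num.Theory.
Import numFieldNormedType.Exports.

Local Open Scope classical_set_scope.
Local Open Scope ring_scope.
Local Open Scope ereal_scope.

(** Write P(r) for the sum of the (mu x nu)-masses of the balls B((0,c),r) and
    B((1,b),r).  By Tonelli, (mu * nu)(B(c,r)) is the (mu x nu)-mass of the
    strip |x + y - c| < r.  Up to a null set, mu lives on [0,1] and nu lives
    outside the gap (b,c), since the complement of a support is null.  As
    c = b + 1, a point of the strip with 0 <= x <= 1 and y >= c has both x and
    y - c in [0,r), while one with y <= b has both 1 - x and b - y in [0,r).  Hence
    (mu * nu)(B(c,r)) <= P(r) ([convolution_ball_le]).  Conversely both balls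
    lie in the strip |x + y - c| < 2r, and they are disjoint once r < 1/2, so
    that P(r) <= (mu * nu)(B(c,2r)) ([le_convolution_ball]).

    Dividing logarithms by log r < 0 reverses inequalities, so the first bound
    gives one half of the equality ([le_log_limsup]); the second bound gives
    the other half because a fixed scaling of the radius does not change the
    upper limit of such quotients ([le_log_limsup_scale]).  The final
    inequality holds since P(r) dominates the mass of each of the two balls. *)

(** * Upper limits along a filter *)

Lemma lee_ltP {R : realType} (x y : \bar R) :
  (forall a : R, y < a%:E -> x <= a%:E) -> x <= y.
Proof.
case: y => [y| |] xy.
- by apply/lee_addgt0Pr => e e0; apply: xy; rewrite lte_fin ltrDl.
- exact: leey.
- case: x xy => [x| |]// xy; last by have := xy 0%R (ltNyr _).
  by have := xy (x - 1)%R (ltNyr _); rewrite lee_fin lerBrDr gerDl ler10.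
Qed.

Lemma limf_esup_le {T : choiceType} {X : filteredType T} {R : realType}
    (f : X -> \bar R) (F : set_system X) (a : \bar R) :
  F [set x | f x <= a] -> limf_esup f F <= a.
Proof.
move=> Fa; apply: (@le_trans _ _ (ereal_sup (f @` [set x | f x <= a]))).
  by apply: ereal_inf_lbound; exists [set x | f x <= a].
by apply: ge_ereal_sup => _ [x /= fxa <-].
Qed.

Lemma limf_esup_lt {T : choiceType} {X : filteredType T} {R : realType}
    (f : X -> \bar R) (F : set_system X) {FF : Filter F} (a : \bar R) :
  limf_esup f F < a -> F [set x | f x < a].
Proof.
move=> /ereal_inf_lt[_ [V FV <-]] fVa.
apply: filterS FV => x Vx /=; apply: le_lt_trans fVa.
by apply: ereal_sup_ubound; exists x.
Qed.

Lemma le_limf_esup {T : choiceType} {X : filteredType T} {R : realType}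
    (f g : X -> \bar R) (F : set_system X) {FF : Filter F} :
  F [set x | f x <= g x] -> limf_esup f F <= limf_esup g F.
Proof.
move=> fg; apply: lee_ltP => a /limf_esup_lt ga; apply: limf_esup_le.
by apply: filterS2 fg ga => x /= /le_lt_trans fg /fg /ltW.
Qed.

(** * Logarithmic quotients near zero *)

Lemma near_right0_scale {R : realType} {k : R} {P : set R} : (0 < k)%R ->
  (\forall r \near 0^'+, P r) -> \forall r \near 0^'+, P (k * r)%R.
Proof.
move=> k0 [e /= e0 eP]; near=> r.
have r0 : (0 < r)%R by near: r; exact: nbhs_right_gt.
apply: eP => /=; last by rewrite mulr_gt0.
rewrite sub0r normrN gtr0_norm ?mulr_gt0// mulrC -ltr_pdivlMr//.
by near: r; apply: nbhs_right_lt; rewrite divr_gt0.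
Unshelve. all: by end_near. Qed.

Lemma near_right0_ln_lt {R : realType} (M : R) :
  \forall r \near 0^'+, (ln r < M)%R.
Proof.
near=> r.
have r0 : (0 < r)%R by near: r; exact: nbhs_right_gt.
rewrite -ltr_expR lnK//; near: r.
by apply: nbhs_right_lt; exact: expR_gt0.
Unshelve. all: by end_near. Qed.

Lemma le_lne {R : realType} {x y : \bar R} : 0 <= x -> x <= y ->
  lne x <= lne y.
Proof.
by move=> x0 xy; rewrite lee_lne// in_itv/= leey andbT// (le_trans x0).
Qed.

Lemma le_lne_div_ln {R : realType} (x y : \bar R) (r : R) :
  (ln r < 0)%R -> 0 <= x -> x <= y ->
  lne y / (ln r)%:E <= lne x / (ln r)%:E.
Proof.
move=> r0 x0 xy; rewrite inver lt_eqF// lee_ndivrMr//.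
by rewrite -muleA -EFinM mulVf ?lt_eqF// mule1 le_lne.
Qed.

Lemma le_log_limsup {R : realType} (f g : R -> \bar R) :
  (\forall r \near 0^'+, 0 <= f r <= g r) ->
  limf_esup (fun r : R => lne (g r) / (ln r)%:E) 0^'+ <=
  limf_esup (fun r : R => lne (f r) / (ln r)%:E) 0^'+.
Proof.
move=> fg; apply: le_limf_esup.
apply: filterS2 fg (near_right0_ln_lt 0) => r /= /andP[f0 fg] r0.
exact: le_lne_div_ln.
Qed.

(** Scaling the radius by k adds the constant ln k to ln r, which is negligible
    against ln r as r tends to 0. *)
Lemma le_log_limsup_scale {R : realType} (k : R) (f g : R -> \bar R) :
  (0 < k)%R ->
  (\forall r \near 0^'+, 0 <= f r <= g (k * r)%R) ->
  limf_esup (fun r : R => lne (g r) / (ln r)%:E) 0^'+ <=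
  limf_esup (fun r : R => lne (f r) / (ln r)%:E) 0^'+.
Proof.
move=> k0 fg; apply: lee_ltP => a /limf_esup_lt fa.
apply/lee_addgt0Pr => e e0; rewrite -EFinD; apply: limf_esup_le.
(* The hypotheses at radius r = s / k are turned into a bound at radius s. *)
have k'0 : (0 < k^-1)%R by rewrite invr_gt0.
have {fg fa}H := near_right0_scale k'0
  (filterI fg (filterI fa (near_right0_ln_lt 0))).
near=> s.
have s0 : (0 < s)%R by near: s; exact: nbhs_right_gt.
have [/= /andP[f0]] : [set r | 0 <= f r <= g (k * r)%R /\
    lne (f r) / (ln r)%:E < a%:E /\ (ln r < 0)%R] (k^-1 * s)%R.
  by near: s; exact: H.
rewrite mulrA divff ?gt_eqF// mul1r => fg [fa lnks0].
have lns0 : (ln s < 0)%R by near: s; exact: near_right0_ln_lt.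
rewrite inver lt_eqF// lee_ndivrMr//.
apply: le_trans (le_lne f0 fg).
move: fa; rewrite inver lt_eqF// lte_ndivrMr// => /ltW; apply: le_trans.
rewrite -!EFinM lee_fin lnM ?posrE// lnV ?posrE//.
(* From a (ln s - ln k) < lne (g s) to (a + e) ln s <= lne (g s). *)
suff : (e * ln s <= - (a * ln k))%R by lra.
rewrite -ler_pdivlMl//; apply/ltW; near: s; exact: near_right0_ln_lt.
Unshelve. all: by end_near. Qed.

(** * Supports and product measures *)

(** The complement of the support is covered by the countably many null balls
    with rational center and rational radius. *)
Lemma negligible_setC_supp {R : realType}
    (mu : {measure set (measurableTypeR R) -> \bar R}) :
  mu.-negligible (~` supp (mu : set R -> \bar R)).
Proof.
pose B (q : rat * rat) : set R := ball (ratr q.1 : R) (ratr q.2 : R).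
pose F n : set R := if unpickle n is Some q then
  (if mu (B q) == 0 then B q else set0) else set0.
apply: (@negligibleS _ _ _ mu (\bigcup_n F n)); last first.
  apply: negligible_bigcup => n; rewrite /F.
  case: unpickle => [q|]; last exact: negligible_set0.
  case: ifPn => [/eqP q0|_]; last exact: negligible_set0.
  by apply/negligibleP => //; exact: measurable_ball.
move=> x /= /existsNP[r /not_implyP[r0 /negP]]; rewrite -leNgt => mur.
have [e] : exists e : rat, ratr e \in `]r / 4, r / 2[%R.
  by apply: rat_in_itvoo; lra.
rewrite in_itv/= => /andP[re er].
have [q] : exists q : rat, ratr q \in `](x - r / 4)%R, (x + r / 4)%R[%R.
  by apply: rat_in_itvoo; lra.
rewrite in_itv/= => /andP[qx xq].
have Bx : B (q, e) `<=` (ball x r : set R).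
  move=> y; rewrite /B !ball_itv/= !in_itv/= => /andP[? ?].
  by apply/andP; split; lra.
exists (pickle (q, e)); [exact: I|rewrite /F pickleK ifT].
  by rewrite /B ball_itv/= in_itv/=; apply/andP; split; lra.
rewrite -measure_le0; apply: le_trans mur.
by apply: le_measure => //; rewrite inE; exact: measurable_ball.
Qed.

(** To compare masses under mu x nu, it suffices to compare the sets on a
    rectangle A x B with sides of full measure. *)
Lemma le_product_measure d1 d2 (T1 : measurableType d1)
    (T2 : measurableType d2) (R : realType)
    (mu : {measure set T1 -> \bar R})
    (nu : {sigma_finite_measure set T2 -> \bar R})
    (A : set T1) (B : set T2) (S U : set (T1 * T2)) :
  mu.-negligible (~` A) -> nu.-negligible (~` B) ->
  measurable S -> measurable U -> S `&` (A `*` B) `<=` U ->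
  (mu \x nu) S <= (mu \x nu) U.
Proof.
move=> [M [mM muM AM]] [N [mN nuN BN]] mS mU SU.
have mMT : measurable (M `*` [set: T2]) by exact: measurableX.
have mTN : measurable ([set: T1] `*` N) by exact: measurableX.
have muMT : (mu \x nu) (M `*` setT) = 0.
  by rewrite [LHS]product_measure1E// muM mul0e.
have nuTN : (mu \x nu) (setT `*` N) = 0.
  by rewrite [LHS]product_measure1E// nuN mule0.
apply: (@le_trans _ _ ((mu \x nu) (U `|` M `*` setT `|` setT `*` N))).
  apply: le_measure; rewrite ?inE//; first by do 2?apply: measurableU.
  move=> p Sp; have [Mp|Mp] := pselect (M p.1); first by left; right.
  have [Np|Np] := pselect (N p.2); first by right.
  left; left; apply: SU; split=> //; split.
    by apply: contrapT => /AM.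
  by apply: contrapT => /BN.
apply: le_trans (measureU2 _ _ _) _ => //; first exact: measurableU.
rewrite [X in _ + X]nuTN adde0; apply: le_trans (measureU2 _ _ _) _ => //.
by rewrite [X in _ + X]muMT adde0.
Qed.

(** * Balls for a convolution *)

Section convolution_balls.
Context {R : realType}.
Variables mu nu : {finite_measure set (measurableTypeR R) -> \bar R}.

Let T : measurableType _ := (measurableTypeR R * measurableTypeR R)%type.

(** The points of the plane (x, y) with |x + y - c| < r. *)
Definition add_strip (c r : R) : set T :=
  [set p | ball c r (p.1 + p.2)%R].

Lemma measurable_add_strip c r : measurable (add_strip c r).
Proof.
rewrite -[X in measurable X]setTI.
apply: (measurable_funD measurable_fst measurable_snd) => //.
exact: measurable_ball.
Qed.

Lemma convolution_ball c r :
  convolution mu nu (ball c r : set R) = (mu \x nu) (add_strip c r).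
Proof.
rewrite convolutionE; last exact: measurable_ball.
apply/esym/product_measure_unique; last exact: measurable_add_strip.
by move=> A B mA mB; exact: product_measure2E.
Qed.

Lemma measurable_ball_pair (p : R * R) r : measurable (ball p r : set T).
Proof.
have -> : ball p r = (ball p.1 r : set R) `*` (ball p.2 r : set R) by [].
by apply: measurableX; exact: measurable_ball.
Qed.

Lemma ball_sub_add_strip (x y r : R) :
  (ball (x, y) r : set (R * R)) `<=` add_strip (x + y)%R (2 * r)%R.
Proof.
move=> [u v]; rewrite /add_strip/= ball_itv => -[/=].
rewrite !ball_itv/= !in_itv/= => /andP[? ?] /andP[? ?].
by apply/andP; split; lra.
Qed.

(** Up to a null set, the strip |x + y - c| < r lies in the union of the two
    balls, because the gap is as long as the interval carrying mu. *)
Lemma convolution_ball_le (b c r : R) : (c - b = 1)%R ->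
  mu.-negligible (~` `[0%R, 1%R]) ->
  nu.-negligible `]b, c[ ->
  convolution mu nu (ball c r : set R) <=
  (mu \x nu) (ball (0%R : R, c) r) + (mu \x nu) (ball (1%R : R, b) r).
Proof.
move=> cb muC nuC; rewrite convolution_ball.
have mB p : measurable (ball p r : set T) by exact: measurable_ball_pair.
apply: (@le_trans _ _
    ((mu \x nu) (ball (0%R : R, c) r `|` ball (1%R : R, b) r))).
  apply: (@le_product_measure _ _ _ _ _ mu nu `[0%R, 1%R] (~` `]b, c[)) => //.
  - by rewrite setCK.
  - exact: measurable_add_strip.
  - exact: measurableU.
  move=> [x y] []; rewrite /add_strip/= ball_itv/= in_itv/= => /andP[xyr rxy].
  rewrite !in_itv/= => -[/andP[x0 x1] /negP]; rewrite negb_and -!leNgt.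
  move=> /orP[yb|cy]; [right|left]; split; rewrite /= ball_itv/= in_itv/=;
    by apply/andP; split; lra.
by apply: measureU2.
Qed.

Lemma le_convolution_ball (b c r : R) : (c - b = 1)%R -> (r < 2^-1)%R ->
  (mu \x nu) (ball (0%R : R, c) r) + (mu \x nu) (ball (1%R : R, b) r)
  <= convolution mu nu (ball c (2 * r)%R : set R).
Proof.
move=> cb r1; rewrite convolution_ball.
have mB p : measurable (ball p r : set T) by exact: measurable_ball_pair.
have dB : ball (0%R : R, c) r `&` ball (1%R : R, b) r = set0.
  apply/seteqP; split=> // -[x y] [[/= + _] [/= + _]].
  by rewrite !ball_itv/= !in_itv/= => /andP[? ?] /andP[? ?]; lra.
have := measureU (mu \x nu) (mB (0%R, c)) (mB (1%R, b)) dB.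
(* The sum is restated so that it matches the one in the goal syntactically. *)
rewrite -[X in _ = X -> _]/(_ + _) => <-.
apply: le_measure; rewrite ?inE//; first exact: measurableU.
  exact: measurable_add_strip.
move=> p [|] /ball_sub_add_strip.
  by rewrite add0r.
by rewrite (_ : 1 + b = c)%R//; lra.
Qed.

End convolution_balls.

Theorem proposition4p9 (R : realType)
    (mu nu : {finite_measure set (measurableTypeR R) -> \bar R})
    (D b c : R)
    (supp_mu : supp (mu : set R -> \bar R) = `[0%R, 1%R]%classic)
    (nu0 : supp (nu : set R -> \bar R) 0%R)
    (nuD : supp (nu : set R -> \bar R) D)
    (supp_nu : supp (nu : set R -> \bar R) `<=` `[0%R, D]%classic)
    (bc_sub : `]b, c[%classic `<=` `[0%R, D]%classic)
    (bc_gap : is_gap (supp (nu : set R -> \bar R)) b c)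
    (bc_length : (c - b = 1)%R) :
  let munu : set (R * R) -> \bar R := mu \x nu in
  let L : \bar R := limf_esup (fun r : R =>
    lne (munu (ball (0%R : R, c) r) + munu (ball (1%R : R, b) r))
      / (ln r)%:E) 0^'+ in
  upper_local_dim (convolution mu nu : set R -> \bar R) c = L /\
  L <= mine (upper_local_dim munu (0%R : R, c))
            (upper_local_dim munu (1%R : R, b)).
Proof.
have [_ _ _ _ gap] := bc_gap.
move=> munu L.
have mu01 : mu.-negligible (~` `[0%R, 1%R]).
  by have := negligible_setC_supp mu; rewrite supp_mu.
have nubc : nu.-negligible `]b, c[.
  apply: negligibleS (negligible_setC_supp nu) => y ybc ysupp.
  by have : (set0 : set R) y by rewrite -gap.
split; last first.
  rewrite le_min; apply/andP; split; apply: le_log_limsup; near=> r;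
    rewrite measure_ge0/=.
  - by rewrite leeDl.
  - by rewrite leeDr.
apply/eqP; rewrite eq_le; apply/andP; split.
  apply: (@le_log_limsup_scale _ 2) => //; near=> r.
  have r2 : (r < 2^-1)%R by near: r; apply: nbhs_right_lt.
  by rewrite adde_ge0//=; exact: le_convolution_ball.
apply: le_log_limsup; near=> r.
by rewrite measure_ge0/=; exact: convolution_ball_le.
Unshelve. all: by end_near. Qed.
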